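(* Given any nonnegative sequence $S$ of $m$ increment and decrement operations and any fair asynchronous activation sequence $A$, the distributed binary counter processes all operations of $S$ in $\mathcal{O}(m)$ asynchronous rounds (with a constant independent of $S$, $m$ and $A$).
   Context: Distributed binary counter. Particles (static, each with constant memory) form a simple path $\ell=P_0,P_1,\ldots,P_k$, with $k$ large enough that the counter never runs past $P_k$. Each $P_i$ stores $P_i.\text{bit}\in\{\emptyset,0,1\}$ and a FIFO queue $P_i.\text{tokens}$ of tokens; $P_0$ can hold at most one token, every other particle at most two (''full'' means holding two tokens). Tokens are increments $c^+$, decrements $c^-$, and a unique final token $f$. Initially $P_0.\text{bit}=0$, $P_0$ holds no token, $P_1.\text{tokens}=[f]$, and $P_i.\text{bit}=\emptyset$ for $i\ge1$, all other queues being empty. When $P_i$ is activated it considers the first non-final token in its queue, if any. - If it is $c^+$: if $P_i.\text{bit}=0$, $P_i$ consumes (deletes) $c^+$ and sets its bit to $1$; if $P_i.\text{bit}=1$ and $P_{i+1}.\text{tokens}$ is not full, $P_i$ moves $c^+$ to the end of $P_{i+1}.\text{tokens}$ and sets its bit to $0$; if $P_i.\text{bit}=\emptyset$ (then $P_i$ also holds $f$), $P_i$ moves $f$ to $P_{i+1}$, consumes $c^+$ and sets its bit to $1$. - If it is $c^-$: if $P_i.\text{bit}=1$ and it is not the case that both $P_{i+1}.\text{bit}=1$ and $P_{i+1}.\text{tokens}=[c^-]$, then $P_i$ consumes $c^-$ and sets its bit to $0$, and if moreover $P_{i+1}.\text{tokens}=[f]$ and $i\ne0$, $P_i$ takes $f$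 from $P_{i+1}$ into its own queue and sets its bit to $\emptyset$; if $P_i.\text{bit}=0$ and $P_{i+1}.\text{tokens}$ is not full, $P_i$ moves $c^-$ to the end of $P_{i+1}.\text{tokens}$ and sets its bit to $1$. - In all other cases nothing happens. In addition, when the leader $P_0$ is activated and, after it has considered the first non-final token in its queue (if any) and carried out the resulting consumption or move of that $c^+$ or $c^-$ token (if any), holds no token, it generates the token ($c^+$ or $c^-$) of the next operation of $S$, if any remain. A sequence $S$ of $m$ operations is nonnegative if for every $0\le i\le m$ its first $i$ operations contain at least as many increments as decrements. An operation is processed when its token has been generated and consumed. Executions are sequences of activations, one particle at a time; fair means every particle is activated infinitely often. An asynchronous round is complete once every particle has been activated at least once since the end of the previous round. *)

(* Defs.v *)
From HB Require Import structures.
From mathcomp Require Import all_boot.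
Set Implicit Arguments.
Unset Strict Implicit.
Unset Printing Implicit Defensive.

Variant op := Inc | Dec.

Variant token := Op of op | Final.

Definition token_code (x : token) : option bool :=
  match x with Op Inc => Some true | Op Dec => Some false | Final => None end.
Definition token_decode (x : option bool) : token :=
  match x with
  | Some true => Op Inc | Some false => Op Dec | None => Final
  end.
Lemma token_codeK : cancel token_code token_decode.
Proof. by do 2?case. Qed.
HB.instance Definition _ := Equality.copy token (can_type token_codeK).

(* [bit = None] encodes the empty bit; the head of [tokens] is the front of the
   FIFO queue. *)
Record particle := Particle { bit : option bool; tokens : seq token }.

(* [particles c i] is P_i and [todo c] lists the operations whose tokens have
   not been generated yet. The finite path P_0, ..., P_k is embedded in a
   sequence indexed by nat: the particles with index > k are never activated,
   and [never_runs_past] says that none of them ever receives a token, so that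
   they only stand for the absence of a particle. *)
Record config := Config { particles : nat -> particle; todo : seq op }.

Definition init_particle (i : nat) : particle :=
  match i with
  | 0 => Particle (Some false) [::]
  | 1 => Particle None [:: Final]
  | _ => Particle None [::]
  end.

Definition init (ops : seq op) : config := Config init_particle ops.

Definition upd (P : nat -> particle) (i : nat) (p : particle) :
  nat -> particle := fun j => if j == i then p else P j.

Definition full (p : particle) : bool := size (tokens p) == 2.

Fixpoint first_op (q : seq token) : option op :=
  match q with
  | [::] => None
  | Op o :: _ => Some o
  | Final :: q' => first_op q'
  end.

Definition push (p : particle) (x : token) : particle :=
  Particle (bit p) (rcons (tokens p) x).

(* [rem (Op o)] deletes the first occurrence of [Op o], which is the token under
   consideration since [first_op] returned [Some o]. *)
Definition process (i : nat) (P : nat -> particle) : nat -> particle :=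
  let p := P i in
  let p' := P i.+1 in
  match first_op (tokens p), bit p with
  | Some Inc, Some false =>
      upd P i (Particle (Some true) (rem (Op Inc) (tokens p)))
  | Some Inc, Some true =>
      if full p' then P
      else upd (upd P i (Particle (Some false) (rem (Op Inc) (tokens p))))
               i.+1 (push p' (Op Inc))
  | Some Inc, None =>
      if Final \in tokens p then
        upd (upd P i (Particle (Some true)
                        (rem Final (rem (Op Inc) (tokens p)))))
            i.+1 (push p' Final)
      else P
  | Some Dec, Some true =>
      if (bit p' == Some true) && (tokens p' == [:: Op Dec]) then P
      else if (tokens p' == [:: Final]) && (i != 0) then
        upd (upd P i (Particle None (rcons (rem (Op Dec) (tokens p)) Final)))
            i.+1 (Particle (bit p') [::])
      else upd P i (Particle (Some false) (rem (Op Dec) (tokens p)))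
  | Some Dec, Some false =>
      if full p' then P
      else upd (upd P i (Particle (Some true) (rem (Op Dec) (tokens p))))
               i.+1 (push p' (Op Dec))
  | Some Dec, None | None, _ => P
  end.

Definition generate (c : config) : config :=
  let p := particles c 0 in
  match tokens p, todo c with
  | [::], o :: ops => Config (upd (particles c) 0 (Particle (bit p) [:: Op o])) ops
  | _, _ => c
  end.

Definition activate (i : nat) (c : config) : config :=
  let c' := Config (process i (particles c)) (todo c) in
  if i == 0 then generate c' else c'.

(* Configuration reached from the initial one by the activations
   A 0, ..., A t.-1. *)
Fixpoint run (k : nat) (ops : seq op) (A : nat -> 'I_k.+1) (t : nat) : config :=
  if t is t'.+1 then activate (A t') (run ops A t') else init ops.

Definition never_runs_past (k : nat) (ops : seq op) (A : nat -> 'I_k.+1) : Prop :=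
  forall t : nat, tokens (particles (run ops A t) k.+1) = [::].

Definition nonnegative (ops : seq op) : Prop :=
  forall i : nat, i <= size ops ->
    count (fun o => if o is Dec then true else false) (take i ops) <=
    count (fun o => if o is Inc then true else false) (take i ops).

Definition fair (k : nat) (A : nat -> 'I_k.+1) : Prop :=
  forall (i : 'I_k.+1) (t : nat), exists2 s, t <= s & A s = i.

Definition all_activated (k : nat) (A : nat -> 'I_k.+1) (t t' : nat) : Prop :=
  forall i : 'I_k.+1, exists2 s, t <= s < t' & A s = i.

(* [round_end A r t]: the r-th asynchronous round is complete exactly after the
   first t activations; the first round starts at time 0. *)
Inductive round_end (k : nat) (A : nat -> 'I_k.+1) : nat -> nat -> Prop :=
| round_end0 : round_end A 0 0
| round_endS r t t' :
    round_end A r t -> all_activated A t t' ->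
    (forall u, all_activated A t u -> t' <= u) ->
    round_end A r.+1 t'.

(* [process] only ever deletes a token from the system by consuming it, so the
   generated tokens that have been consumed are those held by no particle. *)
Definition all_processed (c : config) : Prop :=
  todo c = [::] /\
  forall (i : nat) (o : op), Op o \notin tokens (particles c i).

(* Main.v *)
(* Number the operations of S from 0. After r rounds, operation s can be at P_i
   only if r <= 2 s + i + 2: inside a queue it waits for an earlier operation,
   and a full or locked neighbour P_(i+1) also holds an earlier operation, whose
   deadline 2 s' + (i + 1) + 2 has then already passed. Since the final token is
   never beyond P_(s+1) while s is present, i <= s + 1, so 4 m rounds suffice.
   The only other way to get stuck would be a decrement reaching the holder of
   the final token. This is excluded because the number stored by
   P_i, P_(i+1), ... never becomes negative when their tokens are executed from
   the right to the left, a property every activation preserves. *)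
Require Import Defs.
From mathcomp Require Import all_boot.
From mathcomp Require Import zify.
Set Implicit Arguments.
Unset Strict Implicit.
Unset Printing Implicit Defensive.

(** * Operation tokens of a queue, and their execution on a number *)

Definition token_op (x : token) : option op := if x is Op o then Some o else None.

Definition queue_ops (q : seq token) : seq op := pmap token_op q.

Definition pending (P : nat -> particle) (i : nat) : seq op :=
  queue_ops (tokens (P i)).

Definition bit_value (p : particle) : nat := bit p == Some true.

Definition is_inc (o : op) : bool := if o is Inc then true else false.

Definition set_at {T : Type} (f : nat -> T) (i : nat) (x : T) : nat -> T :=
  fun j => if j == i then x else f j.

(** Partiality encodes nonnegativity: the result is [None] as soon as a decrement meets zero. *)
Fixpoint exec (v : nat) (q : seq op) : option nat :=
  match q with
  | [::] => Some v
  | Inc :: q' => exec v.+1 q'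
  | Dec :: q' => if v is v'.+1 then exec v' q' else None
  end.

Lemma first_opE q : first_op q = ohead (queue_ops q).
Proof. by elim: q => [|[o|] q IH]. Qed.

Lemma queue_ops_rem o q s :
  queue_ops q = o :: s -> queue_ops (rem (Op o) q) = s.
Proof.
elim: q => [//|x q IH] /=; case: eqP => [->|]; first by case.
by case: x => [o' ne [E]|_ /IH //]; case: ne; rewrite E.
Qed.

Lemma queue_ops_rem_final q : queue_ops (rem Final q) = queue_ops q.
Proof. by elim: q => [|[[]|] q IH] //=; rewrite ?IH. Qed.

Lemma queue_ops_rcons q x :
  queue_ops (rcons q x) =
  if token_op x is Some o then rcons (queue_ops q) o else queue_ops q.
Proof.
rewrite -cats1 /queue_ops pmap_cat /=.
by case: x => [o|] /=; rewrite ?cats0 ?cats1.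
Qed.

Lemma op_neq_final o : (Op o == Final) = false.
Proof. by case: o. Qed.

Lemma count_final_rem o q :
  count_mem Final (rem (Op o) q) = count_mem Final q.
Proof.
elim: q => [//|x q IH] /=; case: eqP => [->|_] /=; last by rewrite IH.
by rewrite op_neq_final.
Qed.

Lemma size_queue q : size q = size (queue_ops q) + count_mem Final q.
Proof. by elim: q => [|[[]|] q IH] //=; rewrite IH ?addnS. Qed.

Lemma exec_cat v q1 q2 : exec v (q1 ++ q2) = obind (exec^~ q2) (exec v q1).
Proof. by elim: q1 v => [|[] q1 IH] [|v] //=; rewrite ?IH. Qed.

(** The offset [v] makes the induction on [ops] go through; the hypothesis on $S$ is the case
    [v = 0]. *)
Lemma exec_nonnegative v ops :
  (forall i, i <= size ops ->
    count (fun o => if o is Dec then true else false) (take i ops) <=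
    v + count (fun o => if o is Inc then true else false) (take i ops)) ->
  exec v ops.
Proof.
elim: ops v => [//|[] ops IH] v H /=.
  by apply: IH => i /(H i.+1) /=; lia.
case: v H => [|v] H; first by have := H 1 isT; rewrite /= take0.
by apply: IH => i /(H i.+1) /=; lia.
Qed.

(** Carry rule, $1+2u+1=0+2(u+1)$, and borrow rule, $0+2u-1=1+2(u-1)$. The borrow succeeds only for
    positive [u], which is what success of the left execution provides. *)
Lemma exec_forward o q u y :
  exec (is_inc o + 2 * u) (o :: q) = Some y ->
  exists2 u', exec u [:: o] = Some u' & exec (~~ is_inc o + 2 * u') q = Some y.
Proof.
case: o => /= [H|].
  by exists u.+1 => //; rewrite -H; congr (exec _ q); lia.
case: u => [//|u H]; exists u => //.
by rewrite -H; have ->: 0 + 2 * u.+1 = (1 + 2 * u).+1 by lia.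
Qed.

(** * Safety: the final token and the represented number *)

(** [F] is the index of the holder of the final token. Together, [bit_none] and [pending_beyond]
    leave [F] as the only place where an operation can meet an empty bit. *)
Record well_formed (P : nat -> particle) (F : nat) : Prop := WellFormed {
  final_gt0 : 0 < F;
  final_count i : count_mem Final (tokens (P i)) = (i == F);
  bit_none i : (bit (P i) == None) = (F <= i);
  pending_beyond i : F < i -> pending P i = [::] }.

(* [U i] is the number stored by P_i, P_(i+1), ... in units of 2^i, once all
   tokens they hold have been executed. *)
Record represents (P : nat -> particle) (F : nat) (U : nat -> nat) : Prop :=
  Represents {
  exec_pending i :
    exec (bit_value (P i) + 2 * U i.+1) (pending P i) = Some (U i);
  value_beyond i : F < i -> U i = 0 }.

(** All that the deadline argument needs to know of an activation; bits are forgotten. The last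
    premise of [Stayed] says that waiting has a cause at the right neighbour. The bound in
    [Consumed] covers plain consumption and both shifts of the final token; only its holder can push
    it one step right. *)
Variant moved (Q Q' : nat -> seq op) (F F' i : nat) : Prop :=
| Stayed of F' = F & Q' =1 Q & (Q i.+1 = [::] -> Q i = [::])
| Consumed o q of F' <= F + (i == F) & Q i = o :: q & Q' =1 set_at Q i q
| Forwarded o q of F' = F & Q i = o :: q &
    Q' =1 set_at (set_at Q i q) i.+1 (rcons (Q i.+1) o).

(** At most one of the two tokens is final. *)
Lemma full_pending P F i : well_formed P F -> full (P i) -> pending P i <> [::].
Proof.
move=> [_ cF _ _]; rewrite /full size_queue cF -/(pending P i).
by case: (pending P i) => //=; case: (i == F).
Qed.

Definition simulates P F U i P' : Prop :=
  exists F' U', [/\ well_formed P' F', represents P' F' U', U' 0 = U 0 &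
    moved (pending P) (pending P') F F' i].

(** * Each kind of move preserves the represented number *)

(** Without carry or borrow only the bit of [P i] changes, exactly as executing [o] changes it, so
    [U] is kept. *)
Lemma consume_ok P F U i o q :
  well_formed P F -> represents P F U ->
  pending P i = o :: q -> bit (P i) = Some (~~ is_inc o) ->
  simulates P F U i
    (upd P i (Particle (Some (is_inc o)) (rem (Op o) (tokens (P i))))).
Proof.
move=> wP rP Qi bi; set P' := upd _ _ _.
have QP' : pending P' =1 set_at (pending P) i q.
  move=> j; rewrite /pending /P' /upd /set_at; case: (j =P i) => [_|//] /=.
  exact: queue_ops_rem.
have iF : (F <= i) = false by rewrite -(bit_none wP) bi.
exists F, U; split=> //; last by apply: Consumed Qi QP'; rewrite leq_addr.
  split=> [|j|j|j Fj]; first exact: final_gt0 wP.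
  - rewrite /P' /upd; case: (j =P i) => [->|_] /=; rewrite ?count_final_rem;
      exact: final_count wP _.
  - rewrite /P' /upd; case: (j =P i) => [->|_] /=; last exact: bit_none wP _.
    by rewrite iF.
  - rewrite QP' /set_at; case: (j =P i) => [E|_]; first by lia.
    exact: pending_beyond wP _ Fj.
split=> [j|]; last exact: value_beyond rP.
rewrite QP' /set_at /P' /upd; case: (j =P i) => [->|_]; last exact: exec_pending rP _.
have := exec_pending rP i; rewrite Qi /bit_value bi /=.
by case: (o) => H; rewrite -H.
Qed.

Lemma forward_ok P F U i o q :
  well_formed P F -> represents P F U ->
  pending P i = o :: q -> bit (P i) = Some (is_inc o) ->
  simulates P F U i
    (upd (upd P i (Particle (Some (~~ is_inc o)) (rem (Op o) (tokens (P i)))))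
         i.+1 (push (P i.+1) (Op o))).
Proof.
move=> wP rP Qi bi; set P' := upd _ i.+1 _.
have QP' : pending P' =1
    set_at (set_at (pending P) i q) i.+1 (rcons (pending P i.+1) o).
  move=> j; rewrite /pending /P' /upd /set_at; case: (j =P i.+1) => [_|_] /=.
    by rewrite queue_ops_rcons.
  by case: (j =P i) => [_|//] /=; apply: queue_ops_rem.
have iF : (F <= i) = false by rewrite -(bit_none wP) bi.
have := exec_pending rP i; rewrite Qi /bit_value bi.
have -> : (Some (is_inc o) == Some true) = is_inc o :> bool by case: (o).
move=> /exec_forward[u' Hu' Hq].
(* [o] joins the end of the queue of [P i.+1], hence is executed last there and acts on [U i.+1]
   itself; the carry rule keeps [U i]. *)
exists F, (set_at U i.+1 u'); split=> //; last exact: Forwarded Qi QP'.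
- split=> [|j|j|j Fj]; first exact: final_gt0 wP.
  + rewrite /P' /upd; case: (j =P i.+1) => [->|_] /=.
      by rewrite -cats1 count_cat /= op_neq_final !addn0 (final_count wP).
    by case: (j =P i) => [->|_] /=; rewrite ?count_final_rem; exact: final_count wP _.
  + rewrite /P' /upd; case: (j =P i.+1) => [->|_] /=; first exact: bit_none wP _.
    by case: (j =P i) => [->|_] /=; [rewrite iF | exact: bit_none wP _].
  + rewrite QP' /set_at; case: (j =P i.+1) => [|_]; first by lia.
    case: (j =P i) => [|_]; first by lia.
    exact: pending_beyond wP _ Fj.
- split=> [j|j Fj]; last first.
    by rewrite /set_at; case: (j =P i.+1) => [|_]; [lia | exact: value_beyond rP _ Fj].
  rewrite QP' /P' /upd /set_at eqSS; case: (eqVneq j i.+1) => [->|ji1].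
    rewrite [i.+1 == i]gtn_eqF //= -cats1 exec_cat.
    by rewrite (exec_pending rP) /= -Hu'.
  case: (j =P i) => [->|_]; last exact: exec_pending rP _.
  by rewrite -Hq /bit_value /=; case: (o).
Qed.

(** An empty bit counts as 0 in [bit_value], so this is a consumption without carry in which the
    final token moves from [i] to [i.+1]. *)
Lemma extend_ok P F U i q :
  well_formed P F -> represents P F U ->
  pending P i = Inc :: q -> bit (P i) = None -> F = i ->
  simulates P F U i
    (upd (upd P i (Particle (Some true)
            (rem Final (rem (Op Inc) (tokens (P i))))))
         i.+1 (push (P i.+1) Final)).
Proof.
move=> wP rP Qi bi Fi; set P' := upd _ i.+1 _.
have QP' : pending P' =1 set_at (pending P) i q.
  move=> j; rewrite /pending /P' /upd /set_at; case: (eqVneq j i.+1) => [->|_] /=.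
    by rewrite gtn_eqF // queue_ops_rcons.
  by case: (j =P i) => [_|//] /=; rewrite queue_ops_rem_final; apply: queue_ops_rem.
have cF : count_mem Final (tokens (P i)) = 1 by rewrite (final_count wP) Fi eqxx.
exists i.+1, U; split=> //.
- split=> // [j|j|j Fj].
  + rewrite /P' /upd; case: (eqVneq j i.+1) => [_|_] /=.
      by rewrite -cats1 count_cat /= (final_count wP) gtn_eqF // Fi.
    case: (j =P i) => [_|ji] /=.
      by rewrite count_rem count_final_rem -has_pred1 has_count count_final_rem cF.
    by rewrite (final_count wP) Fi; case: (j =P i).
  + rewrite /P' /upd; case: (eqVneq j i.+1) => [->|ne] /=.
      by rewrite (bit_none wP); lia.
    by case: (j =P i) => [->|ji] /=; [rewrite ltnn | rewrite (bit_none wP); lia].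
  + rewrite QP' /set_at; case: (j =P i) => [|_]; first by lia.
    by apply: (pending_beyond wP); lia.
- split=> [j|j Fj]; last by apply: (value_beyond rP); lia.
  rewrite QP' /P' /upd /set_at; case: (eqVneq j i.+1) => [->|_].
    by rewrite gtn_eqF // -(exec_pending rP).
  case: (j =P i) => [->|_]; last exact: exec_pending rP _.
  by have := exec_pending rP i; rewrite Qi /bit_value bi.
- by apply: Consumed Qi QP'; rewrite Fi eqxx addn1.
Qed.

Lemma retract_ok P F U i q :
  well_formed P F -> represents P F U ->
  pending P i = Dec :: q -> bit (P i) = Some true ->
  tokens (P i.+1) = [:: Final] -> i != 0 ->
  simulates P F U i
    (upd (upd P i (Particle None (rcons (rem (Op Dec) (tokens (P i))) Final)))
         i.+1 (Particle (bit (P i.+1)) [::])).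
Proof.
move=> wP rP Qi bi Ti1 i_neq0; set P' := upd _ i.+1 _.
have FE : F = i.+1.
  by have := final_count wP i.+1; rewrite Ti1 /=; case: eqP.
have Qi1 : pending P i.+1 = [::] by rewrite /pending Ti1.
have QP' : pending P' =1 set_at (pending P) i q.
  move=> j; rewrite /pending /P' /upd /set_at; case: (eqVneq j i.+1) => [->|_] /=.
    by rewrite gtn_eqF // Ti1.
  by case: (j =P i) => [_|//] /=; rewrite queue_ops_rcons /=; apply: queue_ops_rem.
(* The holder of the final token has an empty bit, no pending operation and value 0 to its right.
   This is needed because [P i.+1] comes to lie beyond the final token. *)
have Ui1 : U i.+1 = 0.
  have := exec_pending rP i.+1; rewrite Qi1 /= (value_beyond rP) ?FE // muln0 addn0.
  have /eqP := bit_none wP i.+1; rewrite FE leqnn /bit_value.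
  by case: (bit _) => //= _ [<-].
exists i, U; split=> //.
- split=> [|j|j|j Fj]; first by rewrite lt0n.
  + rewrite /P' /upd; case: (eqVneq j i.+1) => [->|ji1] /=; first by rewrite gtn_eqF.
    case: (j =P i) => [_|ji] /=.
      by rewrite -cats1 count_cat count_final_rem (final_count wP) FE ltn_eqF.
    by rewrite (final_count wP) FE (negbTE ji1).
  + rewrite /P' /upd; case: (eqVneq j i.+1) => [->|ne] /=.
      by rewrite (bit_none wP) FE leqnn leqnSn.
    by case: (j =P i) => [->|ji] /=; [rewrite leqnn | rewrite (bit_none wP); lia].
  + rewrite QP' /set_at; case: (j =P i) => [|_]; first by lia.
    case: (eqVneq j i.+1) => [-> //|ne].
    by apply: (pending_beyond wP); lia.
- split=> [j|j Fj]; last first.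
    case: (eqVneq j i.+1) => [-> //|ne].
    by apply: (value_beyond rP); lia.
  rewrite QP' /P' /upd /set_at; case: (eqVneq j i.+1) => [->|_].
    by rewrite gtn_eqF // -(exec_pending rP).
  case: (j =P i) => [->|_]; last exact: exec_pending rP _.
  by have := exec_pending rP i; rewrite Qi /bit_value bi.
- by apply: Consumed Qi QP'; rewrite FE; lia.
Qed.

Lemma process_ok P F U i :
  well_formed P F -> represents P F U -> simulates P F U i (process i P).
Proof.
move=> wP rP.
have stay : pending P i = [::] \/ pending P i.+1 <> [::] -> simulates P F U i P.
  move=> E; exists F, U; split=> //; apply: Stayed => // Qi1.
  by case: E => [//|/(_ Qi1)].
rewrite /process first_opE -/(pending P i).
case Qi: (pending P i) => [|o q] /=; first by apply: stay; left.
have iF : i <= F.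
  by rewrite leqNgt; apply/negP => /(pending_beyond wP); rewrite Qi.
have full1 : full (P i.+1) -> simulates P F U i P.
  by move=> fl; apply: stay; right; exact: full_pending wP fl.
case bi: (bit (P i)) => [b|].
  case: o b Qi bi => [] [] Qi bi.
  - by case: ifP => // _; exact: forward_ok Qi bi.
  - exact: consume_ok Qi bi.
  - case: ifP => [/andP[_ /eqP Ti1]|_].
      by apply: stay; right; rewrite /pending Ti1.
    case: ifP => [/andP[/eqP Ti1 i_neq0]|_]; last exact: consume_ok Qi bi.
    exact: retract_ok Qi bi Ti1 i_neq0.
  - by case: ifP => // _; exact: forward_ok Qi bi.
have FE : F = i by apply/eqP; rewrite eqn_leq iF -(bit_none wP) bi.
(* A decrement at the holder of the final token would be executed on $0+2\cdot 0$, contradicting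
   [exec_pending]. *)
case: o Qi => Qi; last first.
  have := exec_pending rP i.
  by rewrite Qi /bit_value bi (value_beyond rP) ?FE.
case: ifP => [_|/negbT]; first exact: extend_ok Qi bi FE.
by rewrite -has_pred1 has_count (final_count wP) FE eqxx.
Qed.

(** * Liveness: labels and deadlines *)

(* [L i] lists, for the operations held by P_i, their positions in the whole
   sequence, of which [n] operations have been generated. *)
Record labelled (Q : nat -> seq op) (F n : nat) (L : nat -> seq nat) : Prop :=
  Labelled {
  label_size i : size (L i) = size (Q i);
  label_sorted i : pairwise ltn (L i);
  label_order i j s s' : i < j -> s \in L i -> s' \in L j -> s' < s;
  label_bound i s : s \in L i -> s < n;
  label_final i s : s \in L i -> F <= s.+1;
  final_bound : F <= n.+1 }.

(* After [r] rounds, and with the particles in [D] already activated during the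
   current round, the deadline of an activated particle is the next round's. *)
Definition timely (r : nat) (D : seq nat) (L : nat -> seq nat) : Prop :=
  forall i s, s \in L i -> r + (i \in D) <= 2 * s + i + 2.

(** Labels travel with their operations. Only [P i] newly has to meet the deadline of the next
    round; each kind of move gains the missing unit in its own way. *)
Lemma moved_ok Q Q' F F' i n L r D :
  (forall j, F < j -> Q j = [::]) -> labelled Q F n L -> timely r D L ->
  moved Q Q' F F' i ->
  exists L', labelled Q' F' n L' /\ timely r (i :: D) L'.
Proof.
move=> Q_gt [sL pL oL nL fL Fn] tL.
have L_gt j : F < j -> L j = [::].
  by move=> Fj; apply/size0nil; rewrite sL Q_gt.
case=> [-> QQ' blk | o q F'F Qi QQ' | o q -> Qi QQ'].
- exists L; split; first by split=> // j; rewrite QQ'.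
  move=> j s jL; have := tL j s jL; rewrite inE.
  case: (eqVneq j i) => //= ji; subst j.
  (* The blocking neighbour holds some [s1 < s], and $r\le 2s_1+(i+1)+2\le 2s+i+1$ leaves one unit
     for [P i]. *)
  case L1: (L i.+1) => [|s1 l].
    have Qi : Q i = [::] by apply/blk/size0nil; rewrite -sL L1.
    by have := sL i; rewrite Qi; case: (L i) jL.
  have s1L : s1 \in L i.+1 by rewrite L1 inE eqxx.
  have := oL _ _ _ _ (ltnSn i) jL s1L; have := tL _ _ s1L; lia.
- case Li: (L i) => [|s0 l]; first by have := sL i; rewrite Li Qi.
  have lL s : s \in l -> s \in L i by rewrite Li inE orbC => ->.
  have s0L : s0 \in L i by rewrite Li inE eqxx.
  have /= /andP[/allP /= s0l pl] : pairwise ltn (s0 :: l) by rewrite -Li.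
  have sub j s : s \in set_at L i l j -> s \in L j.
    by rewrite /set_at; case: (j =P i) => [->|//]; apply: lL.
  exists (set_at L i l); split; last first.
    move=> j s jL; have := tL j s (sub _ _ jL); have := tL i s0 s0L.
    move: jL; rewrite /set_at inE; case: (j =P i) => [-> /s0l|_ _] /=; lia.
  split=> [j|j|j j' s s' jj' /sub Ls /sub Ls'|j s /sub|j s jL|].
  + rewrite QQ' /set_at; case: (j =P i) => // _.
    by have := sL i; rewrite Li Qi => -[].
  + by rewrite /set_at; case: (j =P i).
  + exact: oL jj' Ls Ls'.
  + exact: nL.
  + apply: leq_trans F'F _; have := fL _ _ (sub _ _ jL).
    case: (i =P F) => [iF Fs|_]; last by rewrite addn0.
    (* The final token may advance because the consumed [s0] was the oldest operation: nothing lies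
       beyond [F = i], so every remaining [s] is behind it and $F+1\le s_0+2\le s+1$. *)
    suff : s0 < s by have := fL _ _ s0L; lia.
    case: (ltngtP i j) => [ij|ji|ij].
    * by move/sub: jL; rewrite L_gt // -iF.
    * exact: oL ji (sub _ _ jL) s0L.
    * by move: jL; rewrite ij /set_at eqxx => /s0l.
  + have := nL _ _ s0L; have := fL _ _ s0L; lia.
- case Li: (L i) => [|s0 l]; first by have := sL i; rewrite Li Qi.
  have lL s : s \in l -> s \in L i by rewrite Li inE orbC => ->.
  have s0L : s0 \in L i by rewrite Li inE eqxx.
  have /= /andP[/allP /= s0l pl] : pairwise ltn (s0 :: l) by rewrite -Li.
  set L' := set_at (set_at L i l) i.+1 (rcons (L i.+1) s0).
  have sub j s : s \in L' j ->
      [\/ j = i.+1 /\ s = s0, s \in L j /\ j != i | j = i /\ s \in l].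
    rewrite /L' /set_at; case: (eqVneq j i.+1) => [->|_].
      rewrite mem_rcons inE => /orP[/eqP -> | H]; first by constructor.
      by constructor 2; split=> //; lia.
    by case: (eqVneq j i) => [-> H|_ H]; [constructor 3 | constructor 2].
  have subE j s : s \in L' j -> exists j', s \in L j'.
    by case/sub=> [[_ ->]|[H _]|[_ /lL H]]; [exists i|exists j|exists i].
  exists L'; split; last first.
    move=> j s /sub[[-> ->]|[jL ji]|[-> sl]]; rewrite inE.
    (* Moving one place right raises the deadline of [s0] by one, which suffices even if [P i.+1]
       was already activated in this round. *)
    + have := tL i s0 s0L; rewrite (gtn_eqF (ltnSn i)) orFb.
      by have := leq_b1 (i.+1 \in D); lia.
    + by have := tL j s jL; rewrite (negbTE ji).
    + have := tL i s0 s0L; have := s0l s sl; rewrite eqxx /=; lia.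
  split=> // [j|j|j j' s s' jj' /sub Ls /sub Ls'|j s /subE[j' /nL]|j s /subE[j' /fL]] //.
  + rewrite QQ' /L' /set_at; case: (j =P i.+1) => _.
      by rewrite !size_rcons sL.
    case: (j =P i) => // _.
    by have := sL i; rewrite Li Qi => -[].
  + rewrite /L' /set_at; case: (j =P i.+1) => _; last by case: (j =P i).
    rewrite pairwise_rcons pL andbT; apply/allP => s sL1.
    exact: oL (ltnSn i) s0L sL1.
  + case: Ls Ls' => [[Ej Es]|[jL ji]|[Ej sl]] [[Ej' Es']|[jL' ji']|[Ej' sl']];
      try (subst j); try (subst j'); try (subst s); try (subst s'); try lia.
    * by apply: oL jL'; [|exact: s0L]; lia.
    * by apply: oL jL s0L; lia.
    * exact: oL jj' jL jL'.
    * by apply: oL jL (lL _ sl').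
    * exact: s0l.
    * by apply: oL (lL _ sl) jL'.
Qed.

(** * The invariant within a round and from one round to the next *)

(** [n] operations have been generated. The last two clauses control generation: it keeps a pace of
    one operation per two rounds, and after its first activation the leader holds an operation as
    long as some remain to be generated. *)
Definition invariant (m r : nat) (D : seq nat) (c : config) : Prop :=
  exists F U n L,
  [/\ well_formed (particles c) F, represents (particles c) F U,
      labelled (pending (particles c)) F n L & timely r D L] /\
  [/\ exec (U 0) (todo c), n + size (todo c) = m,
      todo c <> [::] -> r <= 2 * n &
      todo c <> [::] -> (0 < r) || (0 \in D) -> pending (particles c) 0 <> [::]].

Lemma invariant_init ops : nonnegative ops -> invariant (size ops) 0 [::] (init ops).
Proof.
move=> nn; exists 1, (fun=> 0), 0, (fun=> [::]).
have pend i : pending init_particle i = [::] by case: i => [|[|i]].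
split; split=> //=; last by apply: exec_nonnegative.
- split=> //; first by case=> [|[|i]].
  by case=> [|[|i]].
- split=> // i; rewrite /= pend /bit_value; by case: i => [|[|i]].
- by split=> // i; rewrite pend.
Qed.

Lemma moved_pending0 Q Q' F F' i : moved Q Q' F F' i -> 0 < i -> Q' 0 = Q 0.
Proof.
case=> [_ QQ' _|o q _ _ QQ'|o q _ _ QQ'] i_gt0; rewrite QQ' //.
  by rewrite /set_at ltn_eqF.
by rewrite /set_at /= ltn_eqF.
Qed.

(** The new label [n] exceeds all others and enters at the left end, so the order is kept;
    [final_bound] supplies [label_final] for it. *)
Lemma labelled_generate Q Q' F n L :
  labelled Q F n L -> size (Q' 0) = 1 -> Q 0 = [::] ->
  (forall i, 0 < i -> Q' i = Q i) ->
  labelled Q' F n.+1 (set_at L 0 [:: n]).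
Proof.
move=> [sL pL oL nL fL Fn] Q'0 Q0 QQ'.
have sub j s : s \in set_at L 0 [:: n] j -> (j = 0 /\ s = n) \/ (0 < j /\ s \in L j).
  by case: j => [|j]; rewrite /set_at /= ?inE => H; [left; split=> //; apply/eqP | right].
split=> [[|j]|[|j]|j j' s s' jj'|j s|j s|] //=; last by lia.
- by rewrite /set_at /= sL QQ'.
- exact: pL.
- move=> /sub[[Ej ->]|[j0 H]] /sub[[Ej' ->]|[j'0 H']]; try lia.
    exact: nL H'.
  exact: oL jj' H H'.
- by move=> /sub[[_ ->]|[_ /nL]]; lia.
- by move=> /sub[[_ ->]|[_ /fL]]; lia.
Qed.

Lemma invariant_activate m r D c i :
  invariant m r D c -> invariant m r (i :: D) (activate i c).
Proof.
move=> [F [U [n [L [[wP rP lL tL] [exU nm rn busy]]]]]].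
have [F' [U' [wP' rP' U0 mv]]] := process_ok i wP rP.
have [L' [lL' tL']] := moved_ok (pending_beyond wP) lL tL mv.
rewrite /activate; case: (eqVneq i 0) => [i0|i_neq0]; last first.
  exists F', U', n, L'; split; split=> //=; first by rewrite U0.
  rewrite inE eq_sym (negbTE i_neq0) /= => td rD.
  by rewrite (moved_pending0 mv) ?lt0n //; apply: busy.
subst i; rewrite /generate /=.
set P' := process 0 (particles c) in wP' rP' mv lL' *.
have stay : pending P' 0 <> [::] \/ todo c = [::] ->
    invariant m r (0 :: D) (Config P' (todo c)).
  move=> E; exists F', U', n, L'; split; split=> //=; first by rewrite U0.
  by move=> td _; case: E.
(* Since [0 < F'], the leader never holds the final token, so a nonempty queue contains an
   operation. *)
case T0: (tokens (P' 0)) => [|x T]; last first.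
  apply: stay; left=> /(congr1 size)/= Q0.
  have := size_queue (tokens (P' 0)); rewrite -/(pending P' 0) Q0 (final_count wP').
  by rewrite T0 ltn_eqF // (final_gt0 wP').
case td: (todo c) => [|o ops]; first by rewrite -td; apply: stay; right.
have F_gt0 := final_gt0 wP'.
have rn' : r <= 2 * n by apply: rn; rewrite td.
have Q0 : pending P' 0 = [::] by rewrite /pending T0.
set P'' := upd P' 0 _.
have QP'' j : 0 < j -> pending P'' j = pending P' j.
  by move=> j0; rewrite /pending /P'' /upd gtn_eqF.
have ex0 : exec (bit_value (P' 0) + 2 * U' 1) [:: o ] = exec (U 0) [:: o].
  by have := exec_pending rP' 0; rewrite Q0 /= U0 => -[->].
have [u Hu Hops] : exists2 u, exec (U 0) [:: o] = Some u & exec u ops.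
  move: exU; rewrite td -cat1s exec_cat.
  by case: (exec (U 0) [:: o]) => [u|//] H; exists u.
exists F', (set_at U' 0 u), n.+1, (set_at L' 0 [:: n]); split; split=> //=.
- split=> // [j|j|j Fj]; rewrite ?QP'' ?(pending_beyond wP' Fj) //; last by lia.
  + rewrite /P'' /upd; case: (j =P 0) => [->|_] /=; last exact: final_count wP' _.
    by rewrite op_neq_final ltn_eqF.
  + rewrite /P'' /upd; case: (j =P 0) => [->|_] /=; exact: bit_none wP' _.
- split=> [[|j]|[//|j]].
  + by rewrite /set_at /= -Hu -ex0.
  + by rewrite QP'' // /P'' /upd /set_at /=; exact: exec_pending rP' _.
  + by rewrite /set_at /=; exact: value_beyond rP' _.
- exact: labelled_generate lL' _ Q0 QP''.
- move=> [|j] s; rewrite /set_at /=; last exact: tL'.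
  (* The fresh operation is on time because $r+1\le 2n+2$, by the pace of generation. *)
  by rewrite !inE => /eqP ->; have := leq_b1 (0 \in 0 :: D); rewrite !inE; lia.
- by rewrite -nm td addnS.
- by lia.
Qed.

(** Once every particle of the path has been activated, the unit contributed by [D] can be traded
    for an increment of [r]. *)
Lemma invariant_next_round k m r D c :
  (forall i, i <= k -> i \in D) -> (forall i, k < i -> pending (particles c) i = [::]) ->
  invariant m r D c -> invariant m r.+1 [::] c.
Proof.
move=> kD Qk [F [U [n [L [[wP rP lL tL] [exU nm rn busy]]]]]].
have tL' : timely r.+1 [::] L.
  move=> i s iL; case: (leqP i k) => [/kD iD|/Qk Qi].
    by have := tL i s iL; rewrite iD in_nil; lia.
  by have := label_size lL i; rewrite Qi; case: (L i) iL.
have D0 := kD 0 (leq0n k).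
exists F, U, n, L; split; split=> // td; last first.
  by move=> _; apply: busy => //; rewrite D0 orbT.
(* The pace is renewed by an operation [s < n] waiting at the leader: $r+1\le 2s+2\le 2n$. *)
case L0: (L 0) => [|s l].
  by case: busy => //; [rewrite D0 orbT | apply/size0nil; rewrite -(label_size lL) L0].
have sL : s \in L 0 by rewrite L0 inE eqxx.
by have := label_bound lL sL; have := tL' 0 s sL; lia.
Qed.

Lemma invariant_all_processed m r c :
  4 * m <= r -> invariant m r [::] c -> all_processed c.
Proof.
move=> mr [F [U [n [L [[wP rP lL tL] [_ nm rn _]]]]]].
have td : todo c = [::].
  case: (todo c) nm rn => [//|o ops] /= nm rn; have {}rn : r <= 2 * n by apply: rn.
  by lia.
split=> // i o; apply/negP => oi.
have : pending (particles c) i <> [::].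
  rewrite /pending; elim: (tokens _) oi => [//|[o'|] q IH] //=.
  by rewrite inE op_neq_final => /IH.
case Li: (L i) => [|s l].
  by case; apply/size0nil; rewrite -(label_size lL) Li.
have sL : s \in L i by rewrite Li inE eqxx.
have iF : i <= F.
  rewrite leqNgt; apply/negP => /(pending_beyond wP)/(congr1 size).
  by rewrite -(label_size lL) Li.
(* From $i\le F\le s+1$ and $s<m$ the deadline gives $r\le 3s+3\le 3m$, which is below $4m$ as
   $m>0$. *)
have := tL i s sL; have := label_bound lL sL; have := label_final lL sL; lia.
Qed.

(** * Inactive particles, and the invariant at the end of each round *)

Lemma process_other i P j : j != i -> j != i.+1 -> process i P j = P j.
Proof.
move=> /negbTE ji /negbTE ji1; rewrite /process /upd.
case: (first_op _) => [o|//]; case: o (bit (P i)) => [] [[]|] //=;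
 rewrite ?ji1 ?ji //; case: ifP => _; rewrite ?ji1 ?ji //;
  by case: ifP => _; rewrite ?ji1 ?ji.
Qed.

(** Activating [P i] touches only [i] and [i.+1], and activated indices are at most [k]. Index
    [k.+1] itself is left to [never_runs_past]. *)
Lemma tokens_beyond k ops (A : nat -> 'I_k.+1) t j :
  k.+1 < j -> tokens (particles (run ops A t) j) = [::].
Proof.
move=> kj; elim: t => [|t IH] /=; first by case: j kj => [|[|j]].
have Aj := ltn_ord (A t).
have H : tokens (process (A t) (particles (run ops A t)) j) = [::].
  by rewrite process_other ?IH //; lia.
rewrite /activate; case: ifP => // _; rewrite /generate /=.
case: (tokens (process _ _ 0)) => [|x T] //; case: (todo _) => [|o os] //=.
by rewrite /upd gtn_eqF //; lia.
Qed.

Lemma invariant_within_round k m r ops (A : nat -> 'I_k.+1) t u :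
  invariant m r [::] (run ops A t) ->
  exists2 D, invariant m r D (run ops A (t + u)) &
    forall s, t <= s < t + u -> val (A s) \in D.
Proof.
move=> inv; elim: u => [|u [D invD AD]].
  by exists [::]; rewrite ?addn0 // => s; lia.
exists (val (A (t + u)) :: D); first by rewrite addnS; exact: invariant_activate.
move=> s; rewrite inE; case: (eqVneq s (t + u)) => [->|ne]; first by rewrite eqxx.
by move=> s_in; rewrite AD ?orbT //; lia.
Qed.

Lemma invariant_round_end k ops (A : nat -> 'I_k.+1) r t :
  nonnegative ops -> never_runs_past ops A -> round_end A r t ->
  invariant (size ops) r [::] (run ops A t).
Proof.
move=> nn past; elim=> [|{}r {}t t' _ IH all_t' _]; first exact: invariant_init.
have tt' : t <= t' by have [s] := all_t' ord0; lia.
have [D] := invariant_within_round (t' - t) IH; rewrite subnKC // => invD AD.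
apply: invariant_next_round invD => [i ik|i ki].
  have [s s_in Asi] := all_t' (Ordinal (ik : i < k.+1)).
  by have := AD s s_in; rewrite Asi.
rewrite /pending; case: (ltngtP i k.+1) => [|ki'|->]; first by lia.
  by rewrite tokens_beyond.
by rewrite past.
Qed.

(** * Fairness makes every round end *)

Lemma all_activated_exists k (A : nat -> 'I_k.+1) t :
  fair A -> exists t', all_activated A t t'.
Proof.
move=> fA.
suff [t' Ht'] : exists t', forall i : 'I_k.+1, i \in enum 'I_k.+1 ->
    exists2 s, t <= s < t' & A s = i.
  by exists t' => i; apply: Ht'; rewrite mem_enum.
elim: (enum _) => [|i e [t' IH]]; first by exists 0.
have [s ts Asi] := fA i t; exists (maxn t' s.+1) => j; rewrite inE.
case: (eqVneq j i) => [-> _|_ /= /IH[s' s'_in As'j]].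
  by exists s => //; lia.
by exists s' => //; lia.
Qed.

Lemma round_end_exists k (A : nat -> 'I_k.+1) r :
  fair A -> exists t, round_end A r t.
Proof.
move=> fA; elim: r => [|r [t rt]]; first by exists 0; exact: round_end0.
(* A decidable form of [all_activated], so that the least end of the round can be chosen. *)
pose b t' := [forall i, has (fun s => A s == i) (iota t (t' - t))].
have bP t' : reflect (all_activated A t t') (b t').
  apply: (iffP forallP) => [H i|H i].
    have /hasP[s] := H i; rewrite mem_iota => s_in /eqP As.
    by exists s => //; lia.
  have [s s_in As] := H i; apply/hasP; exists s; last exact/eqP.
  by rewrite mem_iota; lia.
have [t' /bP bt'] := all_activated_exists t fA.
case: (ex_minnP (ex_intro b t' bt')) => t'' /bP all_t'' t''_min.
by exists t''; apply: round_endS rt all_t'' _ => u /bP; exact: t''_min.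
Qed.

Theorem theorem11 :
  exists C : nat,
    forall (k : nat) (ops : seq op) (A : nat -> 'I_k.+1),
      nonnegative ops -> fair A -> never_runs_past ops A ->
      exists r t : nat,
        r <= C * size ops /\ round_end A r t /\ all_processed (run ops A t).
Proof.
exists 4 => k ops A nn fA past.
have [t rt] := round_end_exists (4 * size ops) fA.
exists (4 * size ops), t; split=> //; split=> //.
exact: invariant_all_processed (invariant_round_end nn past rt).
Qed.
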